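(* For $|q|<1$ (equivalently, as formal power series in $q$), \begin{align*} \sum_{n=0}^{\infty}\mathrm{OSOME}(n)q^n&=\frac18\left(\frac{f_2}{f_1^2}-\frac{f_1^6}{f_2^3}\right)=\frac18\left(\frac{1}{\varphi(-q)}-\varphi^3(-q)\right),\\ \sum_{n=0}^{\infty}\mathrm{OSOME}_o(n)q^n&=\frac{1}{24\,\varphi(-q)}\left(\varphi^4(q)-2\varphi^4(-q)+1\right),\\ \sum_{n=0}^{\infty}\mathrm{OSOME}_e(n)q^n&=\frac{1}{24\,\varphi(-q)}\left(\varphi^4(q)+\varphi^4(-q)-2\right). \end{align*}
   Context: An overpartition of a nonnegative integer $n$ is a partition of $n$ (a non-increasing sequence of positive integers with sum $n$) in which the first occurrence of each number may be overlined (or not). $\mathrm{OSOME}_o(n)$ (resp. $\mathrm{OSOME}_e(n)$) denotes the sum of all odd (resp. even) overlined parts, taken over all overpartitions of $n$, and $\mathrm{OSOME}(n):=\mathrm{OSOME}_o(n)-\mathrm{OSOME}_e(n)$. For example $\mathrm{OSOME}_o(4)=11$, $\mathrm{OSOME}_e(4)=10$, $\mathrm{OSOME}(4)=1$. Notation: $f_r:=\prod_{j=1}^{\infty}(1-q^{rj})$ for $r\ge 1$, and $\varphi(q):=\sum_{n=-\infty}^{\infty}q^{n^2}$. Powers such as $\varphi^4(q)$ mean $(\varphi(q))^4$. *)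

(* Defs.v *)
From HB Require Import structures.
From mathcomp Require Import all_boot all_order all_algebra.
From mathcomp Require Import boolp.

Set Implicit Arguments.
Unset Strict Implicit.
Unset Printing Implicit Defensive.

Import Order.TTheory GRing.Theory Num.Theory.

(** * Overpartitions *)

(* An overpartition is the list of its parts in non-increasing order, each
   part being paired with a boolean telling whether it is overlined.  The
   [pairwise] condition says that an overlined part is never preceded by an
   equal part, i.e. that only first occurrences may be overlined. *)
Definition is_overpartition (n : nat) (s : seq (nat * bool)) : bool :=
  [&& sorted geq (unzip1 s),
      all (leq 1) (unzip1 s),
      pairwise (fun x y => y.2 ==> (x.1 != y.1)) s
    & sumn (unzip1 s) == n].

(* An overpartition of n has at most n parts, all of them at most n; see
   [mem_overpartitions]. *)
Definition overpartitions (n : nat) : seq (seq (nat * bool)) :=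
  filter (is_overpartition n)
    [seq [seq (nat_of_ord p.1, p.2) | p <- l]
       | l : n.-bseq ('I_n.+1 * bool)].

Definition OSOMEo (n : nat) : nat :=
  \sum_(s <- overpartitions n) \sum_(p <- s | p.2 && odd p.1) p.1.

Definition OSOMEe (n : nat) : nat :=
  \sum_(s <- overpartitions n) \sum_(p <- s | p.2 && ~~ odd p.1) p.1.

Definition OSOME (n : nat) : int := ((OSOMEo n)%:Z - (OSOMEe n)%:Z)%R.

Lemma overpartitions_uniq n : uniq (overpartitions n).
Proof.
rewrite filter_uniq // map_inj_uniq ?enum_uniq // => s t.
move=> /inj_map E; apply/val_inj/E => -[a b] [c d] /= [ac ->].
by congr pair; apply: val_inj.
Qed.

Lemma leq_sumn (s : seq nat) x : x \in s -> x <= sumn s.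
Proof.
elim: s => //= y s IH; rewrite inE => /predU1P[->|/IH h].
  exact: leq_addr.
exact: leq_trans h (leq_addl _ _).
Qed.

Lemma size_leq_sumn (s : seq nat) : all (leq 1) s -> size s <= sumn s.
Proof. by elim: s => //= y s IH /andP[y0 /IH h]; rewrite -add1n leq_add. Qed.

Lemma mem_overpartitions n s :
  (s \in overpartitions n) = is_overpartition n s.
Proof.
rewrite mem_filter andb_idr // => /and4P[_ pos _ /eqP sn].
have szs : size s <= n by rewrite -(size_map fst) -sn size_leq_sumn.
pose t := [seq (inord p.1 : 'I_n.+1, p.2) | p <- s].
have szt : size t <= n by rewrite size_map.
apply/mapP; exists (Bseq szt); first by rewrite mem_enum.
rewrite /= /t -map_comp -[LHS]map_id; apply/eq_in_map => -[x b] xs /=.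
rewrite inordK // ltnS -sn; apply: leq_sumn.
by apply/mapP; exists (x, b).
Qed.

(** * The ring Q[[q]] of formal power series *)

Local Open Scope ring_scope.

Record fps : Type := Fps { coef_fps : nat -> rat }.

Notation "a .[[ n ]]" := (coef_fps a n)
  (at level 2, left associativity, format "a .[[ n ]]") : ring_scope.

Lemma fpsP (a b : fps) : (forall n, a.[[n]] = b.[[n]]) <-> a = b.
Proof.
split=> [|-> //]; case: a b => [a] [b] /= ab.
by congr Fps; apply: funext.
Qed.

HB.instance Definition _ := gen_eqMixin fps.
HB.instance Definition _ := gen_choiceMixin fps.

Definition fps_add (a b : fps) : fps := Fps (fun n => a.[[n]] + b.[[n]]).
Definition fps_opp (a : fps) : fps := Fps (fun n => - a.[[n]]).
Definition fps_const (c : rat) : fps := Fps (fun n => if n == 0%N then c else 0).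
Definition fps_mul (a b : fps) : fps :=
  Fps (fun n => \sum_(i < n.+1) a.[[i]] * b.[[n - i]]).

Lemma fps_addA : associative fps_add.
Proof. by move=> a b c; apply/fpsP => n /=; rewrite addrA. Qed.
Lemma fps_addC : commutative fps_add.
Proof. by move=> a b; apply/fpsP => n /=; rewrite addrC. Qed.
Lemma fps_add0 : left_id (fps_const 0) fps_add.
Proof. by move=> a; apply/fpsP => n /=; rewrite if_same add0r. Qed.
Lemma fps_addN : left_inverse (fps_const 0) fps_opp fps_add.
Proof. by move=> a; apply/fpsP => n /=; rewrite if_same addNr. Qed.

HB.instance Definition _ :=
  GRing.isZmodule.Build fps fps_addA fps_addC fps_add0 fps_addN.

Definition fps_trunc (N : nat) (a : fps) : {poly rat} :=
  \poly_(i < N) a.[[i]].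

Lemma coef_fps_mul_trunc N a b n : (n < N)%N ->
  (fps_mul a b).[[n]] = (fps_trunc N a * fps_trunc N b)`_n.
Proof.
move=> nN; rewrite coefM /=; apply: eq_bigr => i _; rewrite !coef_poly.
by rewrite (leq_ltn_trans (leq_ord i) nN) (leq_ltn_trans (leq_subr i n) nN).
Qed.

Lemma fps_mulC : commutative fps_mul.
Proof.
move=> a b; apply/fpsP => n.
by rewrite !(@coef_fps_mul_trunc n.+1) // mulrC.
Qed.

Lemma fps_mulA : associative fps_mul.
Proof.
move=> a b c; apply/fpsP => n.
transitivity ((fps_trunc n.+1 a * (fps_trunc n.+1 b * fps_trunc n.+1 c))`_n).
  rewrite coefM; apply: eq_bigr => i _.
  by rewrite coef_poly ltn_ord -coef_fps_mul_trunc // ltnS leq_subr.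
rewrite mulrA coefM; apply: eq_bigr => i _.
by rewrite coef_poly ltnS leq_subr -coef_fps_mul_trunc.
Qed.

Lemma fps_mul1 : left_id (fps_const 1) fps_mul.
Proof.
move=> a; apply/fpsP => n /=.
by rewrite big_ord_recl /= mul1r subn0 big1 ?addr0 // => i _; rewrite mul0r.
Qed.

Lemma fps_mulDl : left_distributive fps_mul fps_add.
Proof.
move=> a b c; apply/fpsP => n /=; rewrite -big_split /=.
by apply: eq_bigr => i _; rewrite mulrDl.
Qed.

Lemma fps_one_neq0 : fps_const 1 != 0.
Proof. by apply/eqP => /fpsP /(_ 0%N). Qed.

HB.instance Definition _ := GRing.Zmodule_isComNzRing.Build fps
  fps_mulA fps_mulC fps_mul1 fps_mulDl fps_one_neq0.

Lemma fps_coefD (a b : fps) n : (a + b).[[n]] = a.[[n]] + b.[[n]].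
Proof. by []. Qed.
Lemma fps_coefN (a : fps) n : (- a).[[n]] = - a.[[n]].
Proof. by []. Qed.
Lemma fps_coef0 n : (0 : fps).[[n]] = 0.
Proof. by rewrite /= if_same. Qed.
Lemma fps_coef1 n : (1 : fps).[[n]] = (n == 0%N)%:R.
Proof. by rewrite /=; case: eqP. Qed.
Lemma fps_coefM (a b : fps) n :
  (a * b).[[n]] = \sum_(i < n.+1) a.[[i]] * b.[[n - i]].
Proof. by []. Qed.

Arguments fps_add : simpl never.
Arguments fps_opp : simpl never.
Arguments fps_mul : simpl never.

(* The first n+1 coefficients b_0, ..., b_n of the inverse b of a, from
   a_0 b_0 = 1 and a_0 b_(m+1) = - \sum_(i <= m) a_(m+1-i) b_i. *)
Fixpoint fps_inv_seq (a : fps) (n : nat) : seq rat :=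
  if n is m.+1 then
    let s := fps_inv_seq a m in
    rcons s (- a.[[0]]^-1 * \sum_(i < m.+1) a.[[m.+1 - i]] * s`_i)
  else [:: a.[[0]]^-1].

Definition fps_unit : {pred fps} := fun a => a.[[0]] != 0.

Definition fps_inv (a : fps) : fps :=
  if a \in fps_unit then Fps (fun n => (fps_inv_seq a n)`_n) else a.

Lemma size_fps_inv_seq a n : size (fps_inv_seq a n) = n.+1.
Proof. by elim: n => //= n IH; rewrite size_rcons IH. Qed.

Lemma nth_fps_inv_seq a n i : (i <= n)%N ->
  (fps_inv_seq a n)`_i = (fps_inv_seq a i)`_i.
Proof.
elim: n => [|n IH]; first by rewrite leqn0 => /eqP ->.
rewrite leq_eqVlt => /predU1P[-> //|iltn].
by rewrite /= nth_rcons size_fps_inv_seq iltn IH.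
Qed.

Lemma fps_mulVx : {in fps_unit, left_inverse 1 fps_inv *%R}.
Proof.
move=> a ua; rewrite mulrC; apply/fpsP => n.
rewrite fps_coefM fps_coef1 /fps_inv ua /=.
have a0 : a.[[0]] != 0 := ua.
case: n => [|n]; first by rewrite big_ord_recl big_ord0 addr0 mulfV.
rewrite big_ord_recl /= subn0 nth_rcons size_fps_inv_seq ltnn eqxx.
rewrite mulNr mulrN mulrA mulfV // mul1r.
apply/eqP; rewrite addrC subr_eq0; apply/eqP.
rewrite (reindex_inj rev_ord_inj) /=; apply: eq_bigr => i _.
have ilen : (i <= n)%N by rewrite -ltnS.
rewrite /bump /= add1n !subSS subKn // -subSn //.
by rewrite (nth_fps_inv_seq a ilen).
Qed.

Lemma fps_unitPl (a b : fps) : b * a = 1 -> fps_unit a.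
Proof.
move/fpsP/(_ 0%N); rewrite fps_coefM big_ord_recl big_ord0 addr0 /= => ba.
by apply/eqP => a0; move: ba; rewrite a0 mulr0.
Qed.

Lemma fps_inv_out : {in [predC fps_unit], fps_inv =1 id}.
Proof. by move=> a /negPf ua; rewrite /fps_inv ua. Qed.

HB.instance Definition _ :=
  GRing.ComNzRing_hasMulInverse.Build fps fps_mulVx fps_unitPl fps_inv_out.

Lemma fps_unitE (a : fps) : (a \is a GRing.unit) = (a.[[0]] != 0).
Proof. by []. Qed.

Definition q : fps := Fps (fun n => (n == 1%N)%:R).

(* the substitution q |-> -q *)
Definition negq (a : fps) : fps := Fps (fun n => (-1) ^+ n * a.[[n]]).

(* Convergence in the q-adic topology of Q[[q]], i.e. eventual stability of
   each coefficient. *)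
Definition fps_cvg (u : nat -> fps) (l : fps) : Prop :=
  forall n, exists N0, forall N, (N0 <= N)%N -> (u N).[[n]] = l.[[n]].

(* The q-adic limit of a sequence u whose n-th coefficient is stationary from
   rank n on; [f_cvg] and [phi_cvg] show that this holds below. *)
Definition fps_lim (u : nat -> fps) : fps := Fps (fun n => (u n).[[n]]).

(* f_r = \prod_(j >= 1) (1 - q^(r j)), for r >= 1 *)
Definition f (r : nat) : fps :=
  fps_lim (fun N => \prod_(1 <= j < N.+1) (1 - q ^+ (r * j))).

(* phi(q) = \sum_(k in Z) q^(k^2); the index i stands for k = i - N, so that
   the N-th partial sum is over -N <= k <= N. *)
Definition phi : fps :=
  fps_lim (fun N => \sum_(i < N.*2.+1) q ^+ (`|(i%:Z - N%:Z)%R| ^ 2)%N).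

Lemma fps_coefXn k n : (q ^+ k).[[n]] = (n == k)%:R.
Proof.
elim: k n => [|k IH] n; first by rewrite expr0 fps_coef1.
rewrite exprS fps_coefM; case: n => [|n].
  by rewrite big_ord_recl big_ord0 /= mul0r addr0.
rewrite 2!big_ord_recl big1 /= ?mul0r ?mul1r ?add0r ?addr0; last first.
  by move=> i _; rewrite mul0r.
by rewrite /bump /= subSS subn0 IH.
Qed.

Lemma fps_cvg_lim (u : nat -> fps) :
  (forall n N, (n <= N)%N -> (u N.+1).[[n]] = (u N).[[n]]) ->
  fps_cvg u (fps_lim u).
Proof.
move=> st n; exists n; elim=> [|N IH]; first by rewrite leqn0 => /eqP ->.
by rewrite leq_eqVlt => /predU1P[<- //|nN]; rewrite st // IH.
Qed.

Lemma f_cvg r : (0 < r)%N ->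
  fps_cvg (fun N => \prod_(1 <= j < N.+1) (1 - q ^+ (r * j))) (f r).
Proof.
move=> r0; apply: fps_cvg_lim => n N nN.
rewrite big_nat_recr //; set P : fps := \big[_/_]_(1 <= j < N.+1) _.
rewrite -[LHS]/((P * (1 - q ^+ (r * N.+1))).[[n]]) -[RHS]/(P.[[n]]).
rewrite mulrBr mulr1 fps_coefD fps_coefN.
rewrite fps_coefM big1 ?subr0 // => i _.
rewrite fps_coefXn [_ == _](_ : _ = false) ?mulr0 //.
apply/ltn_eqF/(leq_ltn_trans (leq_subr _ _)).
by rewrite (leq_ltn_trans nN) // leq_pmull.
Qed.

Lemma phi_cvg :
  fps_cvg (fun N => \sum_(i < N.*2.+1) q ^+ (`|(i%:Z - N%:Z)%R| ^ 2)%N) phi.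
Proof.
apply: fps_cvg_lim => n N nN.
have aux k : (N < k)%N -> (q ^+ (k ^ 2)%N).[[n]] = 0.
  move=> Nk; rewrite fps_coefXn ltn_eqF // (leq_ltn_trans nN) //.
  by rewrite (leq_trans Nk) // -[X in (X <= _)%N]muln1 leq_pmul2l ?(leq_trans _ Nk).
rewrite doubleS big_ord_recl big_ord_recr !fps_coefD aux; last first.
  by rewrite sub0r abszN.
rewrite add0r [X in _ + X]aux ?addr0; last first.
  by rewrite lift0 -!addnn -addSn -addnS PoszD addrK.
congr coef_fps; apply: eq_bigr => i _; rewrite lift0.
by rewrite !intS opprD addrACA subrr add0r.
Qed.

(* Main.v *)
Require Import Defs.
From HB Require Import structures.
From mathcomp Require Import all_boot all_order all_algebra.
From mathcomp Require Import ring lra zify.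

(** Write P for the generating function f_2 / f_1^2 = \prod (1+q^j)/(1-q^j) of
    overpartitions.  In P the factor of the part k is
    (1+q^k)/(1-q^k), whose share with k overlined is q^k/(1-q^k); hence giving
    each overlined part k the weight c(k) yields the generating function
    P \sum_k c(k) q^k/(1+q^k) ([overlined_gf]).  With c(k) = k on the odd or on
    the even integers, put
      O = \sum_(k odd) k q^k/(1+q^k),   E = \sum_(k even) k q^k/(1+q^k),
    so that the two series to be found are P O and P E.

    Three facts then give the theorem.
    - Gauss: phi(-q) = 1/P ([negq_phiE]).
    - Jacobi's four-square theorem: phi(-q)^4 = 1 + 8 (E - O)
      ([negq_phi_pow4]).
    - A divisor sum identity: substituting -q for q turns E - O into O + 2 E
      ([negq_lambert]), so that phi(q)^4 = 1 + 8 (O + 2 E).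
    The claimed right-hand sides become linear in O and E.

    Gauss' and Jacobi's identities are limits, as n tends to infinity, of finite
    identities F(n,0) + 2 \sum_(1 <= k <= n) F(n,k) = 1 with terminating
    hypergeometric summands.  The finite ones follow the method of Wilf and
    Zeilberger ([wz_sum]): there is a companion G such that
    F(n+1,k) - F(n,k) = G(n,k) - G(n,k-1), so the sum does not depend on n.
    For Jacobi's theorem, as in the proof by Andrews, Ekhad and Zeilberger,
      F(n,k) = 4 (-q)^k/(1+q^k)^2 A(n)^2 A(n+k) A(n-k),
      A(n) = \prod_(j <= n) (1+q^j)/(1-q^j).
    As A(n) tends to P, the limit is P^4 (1 + 8 \sum_k (-q)^k/(1+q^k)^2) = 1,
    and exchanging the two summations in this Lambert series gives E - O. *)

Set Implicit Arguments.
Unset Strict Implicit.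
Unset Printing Implicit Defensive.

Import GRing.Theory Num.Theory.
Local Open Scope ring_scope.

(** * Limits and series in the q-adic topology *)

Lemma cvg_unique u (a b : fps) : fps_cvg u a -> fps_cvg u b -> a = b.
Proof.
move=> ua ub; apply/fpsP => n; have [N1 h1] := ua n; have [N2 h2] := ub n.
by rewrite -(h1 (maxn N1 N2)) ?leq_maxl // h2 // leq_maxr.
Qed.

Lemma cvg_const (a : fps) : fps_cvg (fun=> a) a.
Proof. by move=> n; exists 0%N. Qed.

Lemma eq_cvg u v (a : fps) : u =1 v -> fps_cvg u a -> fps_cvg v a.
Proof.
by move=> uv ua n; have [N0 h] := ua n; exists N0 => N /h <-; rewrite uv.
Qed.

(** A coefficient of a product involves all the earlier coefficients of its
    factors, so they must be stationary from a common rank on. *)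
Lemma cvg_coefs_le u (a : fps) n : fps_cvg u a ->
  exists N0, forall N m, (N0 <= N)%N -> (m <= n)%N -> (u N).[[m]] = a.[[m]].
Proof.
move=> ua; elim: n => [|n [N1 h1] ].
  have [N0 h] := ua 0%N; exists N0 => N m /h.
  by move=> + m0; rewrite (eqP (etrans (esym (leqn0 m)) m0)).
have [N2 h2] := ua n.+1; exists (maxn N1 N2) => N m.
rewrite geq_max => /andP[l1 l2]; rewrite leq_eqVlt => /predU1P[->|mn].
  exact: h2.
exact: h1.
Qed.

Lemma cvgD u v (a b : fps) : fps_cvg u a -> fps_cvg v b ->
  fps_cvg (fun N => u N + v N) (a + b).
Proof.
move=> ua vb n; have [N1 h1] := ua n; have [N2 h2] := vb n.
exists (maxn N1 N2) => N; rewrite geq_max => /andP[l1 l2].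
by rewrite !fps_coefD h1 ?h2.
Qed.

Lemma cvgM u v (a b : fps) : fps_cvg u a -> fps_cvg v b ->
  fps_cvg (fun N => u N * v N) (a * b).
Proof.
move=> /cvg_coefs_le ua /cvg_coefs_le vb n.
have [N1 h1] := ua n; have [N2 h2] := vb n.
exists (maxn N1 N2) => N; rewrite geq_max => /andP[l1 l2].
rewrite !fps_coefM; apply: eq_bigr => i _.
by rewrite h1 ?h2 ?leq_subr // -ltnS.
Qed.

Lemma cvgX u (a : fps) k : fps_cvg u a -> fps_cvg (fun N => u N ^+ k) (a ^+ k).
Proof.
move=> ua; elim: k => [|k IH]; first exact: cvg_const.
rewrite exprS; apply: (@eq_cvg (fun N => u N * u N ^+ k)) => [N|].
  by rewrite exprS.
exact: cvgM.
Qed.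

Lemma cvg_comp g u (a : fps) :
  (forall N0, exists N1, forall N, (N1 <= N)%N -> (N0 <= g N)%N) ->
  fps_cvg u a -> fps_cvg (fun N => u (g N)) a.
Proof.
move=> gy ua n; have [N0 h] := ua n; have [N1 h1] := gy N0.
by exists N1 => N /h1 /h.
Qed.

Lemma cvg_addn u (a : fps) k : fps_cvg u a -> fps_cvg (fun N => u (N + k)%N) a.
Proof. by apply: cvg_comp => N0; exists N0 => N; lia. Qed.

Lemma cvg_subn u (a : fps) k : fps_cvg u a -> fps_cvg (fun N => u (N - k)%N) a.
Proof. by apply: cvg_comp => N0; exists (N0 + k)%N => N; lia. Qed.

Lemma cvg_inv u (a : fps) : a \is a GRing.unit ->
  (forall N, u N \is a GRing.unit) ->
  fps_cvg u a -> fps_cvg (fun N => (u N)^-1) a^-1.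
Proof.
move=> ua uu /cvg_coefs_le h n; have [N0 h0] := h n.
exists N0 => N /h0 {}h0; apply/eqP; rewrite -subr_eq0 -fps_coefN -fps_coefD.
have -> : (u N)^-1 - a^-1 = (a - u N) * (a^-1 * (u N)^-1).
  by rewrite mulrBl mulrA divrr // mul1r mulrCA divrr // mulr1.
rewrite fps_coefM big1 // => i _.
by rewrite fps_coefD fps_coefN h0 ?subrr ?mul0r // -ltnS.
Qed.

Lemma fps_coefXnM k (a : fps) n :
  (q ^+ k * a).[[n]] = if (k <= n)%N then a.[[n - k]] else 0.
Proof.
rewrite fps_coefM; case: leqP => [kn|nk].
  rewrite (bigD1 (inord k)) //= inordK ?ltnS // fps_coefXn eqxx mul1r.
  rewrite big1 ?addr0 // => i ik; rewrite fps_coefXn.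
  case: eqP => [ik'|]; last by rewrite mul0r.
  by case/eqP: ik; apply: val_inj; rewrite /= inordK ?ltnS.
rewrite big1 // => i _; rewrite fps_coefXn.
case: eqP => [ik'|]; last by rewrite mul0r.
by have := ltn_ord i; lia.
Qed.

Definition fps_series (v : nat -> fps) : fps :=
  fps_lim (fun N => \sum_(1 <= k < N.+1) v k).

Lemma fps_coef_sum (I : Type) (r : seq I) (P : pred I) (F : I -> fps) n :
  (\sum_(i <- r | P i) F i).[[n]] = \sum_(i <- r | P i) (F i).[[n]].
Proof.
elim/big_rec2: _ => [|i x y _ <-]; by rewrite ?fps_coef0.
Qed.

(** Tannery's theorem, dominated convergence for series: the q-adic counterpart
    of domination is that q^k divides the k-th summand, since then only finitely
    many summands contribute to a given coefficient. *)
Lemma tannery (u : nat -> nat -> fps) (v : nat -> fps) :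
  (forall N k n, (n < k)%N -> (u N k).[[n]] = 0) ->
  (forall k, fps_cvg (u^~ k) (v k)) ->
  fps_cvg (fun N => \sum_(1 <= k < N.+1) u N k) (fps_series v).
Proof.
move=> u0 uv n.
have [N0 h] : exists N0, forall N k, (N0 <= N)%N -> (k < n.+1)%N ->
    (u N k).[[n]] = (v k).[[n]].
  elim: n.+1 => [|m [N1 h1] ]; first by exists 0%N.
  have [N2 h2] := uv m n; exists (maxn N1 N2) => N k.
  rewrite geq_max => /andP[l1 l2]; rewrite ltnS leq_eqVlt => /predU1P[->|km].
    exact: h2.
  exact: h1.
exists (maxn n N0) => N; rewrite geq_max => /andP[nN lN].
rewrite /= !fps_coef_sum (@big_cat_nat _ _ _ n.+1) //=.
rewrite [X in _ + X]big_nat_cond [X in _ + X]big1 ?addr0; last first.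
  by move=> k /andP[/andP[nk _] _]; apply: u0.
by apply: eq_big_nat => k /andP[_ kn]; apply: h.
Qed.

Lemma cvg_series v : (forall k n, (n < k)%N -> (v k).[[n]] = 0) ->
  fps_cvg (fun N => \sum_(1 <= k < N.+1) v k) (fps_series v).
Proof. by move=> v0; apply: tannery => // k; apply: cvg_const. Qed.

Lemma coef_lt_order k (a : fps) n : (n < k)%N -> (q ^+ k * a).[[n]] = 0.
Proof. by rewrite fps_coefXnM ltnNge => /negPf ->. Qed.

Lemma fps_seriesMr v (a : fps) : (forall k n, (n < k)%N -> (v k).[[n]] = 0) ->
  fps_series (fun k => v k * a) = fps_series v * a.
Proof.
move=> v0; apply: (@cvg_unique (fun N => \sum_(1 <= k < N.+1) v k * a)).
  apply: cvg_series => k n nk; rewrite fps_coefM big1 // => i _.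
  by rewrite v0 ?mul0r //; apply: leq_ltn_trans nk; rewrite -ltnS.
apply: eq_cvg (cvgM (cvg_series v0) (cvg_const a)) => N.
by rewrite mulr_suml.
Qed.

(** * Summation by the method of Wilf and Zeilberger *)

(** The sum is half of one over -n <= k <= n for a summand even in k; the
    companion G, in the shifted convention where G n k lies between k and k+1, is
    odd under k -> -1-k, which is where the factor 2 at k = 0 comes from.  The
    last condition is the second one at k = n, with F n (n+1) = G n (n+1) = 0. *)
Lemma wz_sum (R : comPzRingType) (F G : nat -> nat -> R) :
  (forall n, F n.+1 0%N - F n 0%N = 2 * G n 0%N) ->
  (forall n k, (k < n)%N -> F n.+1 k.+1 - F n k.+1 = G n k.+1 - G n k) ->
  (forall n, F n.+1 n.+1 = - G n n) ->
  forall n, F n 0%N + 2 * \sum_(1 <= k < n.+1) F n k = F 0%N 0%N.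
Proof.
move=> F0 Fk Fn; elim=> [|n <-]; first by rewrite big_geq // mulr0 addr0.
rewrite big_nat_recr //= Fn -[F n.+1 0%N](subrK (F n 0%N)) F0.
rewrite -addrA addrCA -mulrDr; congr (_ + _ * _).
suff -> : \sum_(1 <= k < n.+1) F n.+1 k =
    G n n - G n 0%N + \sum_(1 <= k < n.+1) F n k.
  by ring.
apply/eqP; rewrite -subr_eq -sumrB !big_add1 /= -(telescope_sumr _ (leq0n n)).
by apply/eqP/eq_big_nat => k /andP[_ /Fk].
Qed.

(** Here and in the next two lemmas X, y, z stand for q^(n+1), q^k, q^(n+1-k),
    and e for (-1)^k.  As X y z = X^2, the difference
    (1-X^2) - (1-X y) (1-z) is X y (1-z) + z (1-X y). *)
Lemma gauss_step (R : comPzRingType) (e p a b b' d d' X y z : R) :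
    X = y * z -> b = b' * (1 - X * y) -> d = d' * (1 - z) ->
  e * p * (a * (1 - X ^+ 2)) * d' * b' - e * p * a * d * b
    = e * (p * y * X) * a * d * b' + e * p * z * a * d' * b.
Proof. by move=> -> -> ->; ring. Qed.

(** The difference (1+X)^2 (1+X y) (1+z) - (1-X)^2 (1-X y) (1-z) is
    2 z (1+X^2) (1+y)^2, so the denominator (1+y)^2 of t cancels; what remains
    telescopes because (1+X y) (1-z) + (1-X y) (1+z) = 2 (1-X^2) does not
    depend on y. *)
Lemma jacobi_step (R : comPzRingType) (e t c al be de X y z : R) :
    X = y * z -> t * (1 + y) ^+ 2 = 4 * e * y ->
    c * (1 - X ^+ 2) = - (al ^+ 2 * (4 * X) * (1 + X ^+ 2)) ->
  t * (al * (1 + X)) ^+ 2 * (be * (1 + X * y)) * (de * (1 + z))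
    - t * (al * (1 - X)) ^+ 2 * (be * (1 - X * y)) * (de * (1 - z))
  = c * (- e * (be * (1 + X * y)) * (de * (1 - z)))
    - c * (e * (be * (1 - X * y)) * (de * (1 + z))).
Proof.
move=> Xyz te ce; rewrite Xyz in ce *.
transitivity (2 * al ^+ 2 * be * de * z * (1 + (y * z) ^+ 2)
  * (t * (1 + y) ^+ 2)); first by ring.
rewrite te.
transitivity (- (2 * e * be * de * (c * (1 - (y * z) ^+ 2))));
  last by ring.
by rewrite ce; ring.
Qed.

(** The boundary case k = n+1, where y = X and z = 1. *)
Lemma jacobi_last (R : comPzRingType) (e t c al be X : R) :
    t * (1 + X) ^+ 2 = 4 * e * X ->
    c * (1 - X ^+ 2) = - (al ^+ 2 * (4 * X) * (1 + X ^+ 2)) ->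
  t * (al * (1 + X)) ^+ 2 * (be * (1 + X * X))
  = - (c * (e * (be * (1 - X * X)))).
Proof.
move=> te ce.
transitivity (al ^+ 2 * be * (1 + X ^+ 2) * (t * (1 + X) ^+ 2)); first by ring.
rewrite te; transitivity (- (e * be * (c * (1 - X ^+ 2)))); last by ring.
by rewrite ce; ring.
Qed.

(** * The infinite products *)

Lemma unit_1subq k : (0 < k)%N -> 1 - q ^+ k \is a GRing.unit.
Proof.
move=> k0; rewrite fps_unitE fps_coefD fps_coefN fps_coefXn fps_coef1.
by case: k k0.
Qed.

Lemma unit_1addq k : 1 + q ^+ k \is a GRing.unit.
Proof. by rewrite fps_unitE fps_coefD fps_coefXn fps_coef1; case: k. Qed.

Definition qpoch (N : nat) : fps := \prod_(1 <= j < N.+1) (1 - q ^+ j).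
Definition qpochN (N : nat) : fps := \prod_(1 <= j < N.+1) (1 + q ^+ j).
(** The generating function of the overpartitions with all parts at most N; see
    [stat_gf_le_count]. *)
Definition overgf_le (N : nat) : fps := qpochN N / qpoch N.

Lemma qpochS N : qpoch N.+1 = qpoch N * (1 - q ^+ N.+1).
Proof. by rewrite /qpoch big_nat_recr. Qed.

Lemma qpochNS N : qpochN N.+1 = qpochN N * (1 + q ^+ N.+1).
Proof. by rewrite /qpochN big_nat_recr. Qed.

Lemma qpoch0 : qpoch 0 = 1. Proof. by rewrite /qpoch big_geq. Qed.
Lemma qpochN0 : qpochN 0 = 1. Proof. by rewrite /qpochN big_geq. Qed.
Lemma overgf_le0 : overgf_le 0 = 1.
Proof. by rewrite /overgf_le qpoch0 qpochN0 divr1. Qed.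

Lemma unit_qpoch N : qpoch N \is a GRing.unit.
Proof.
elim: N => [|N IH]; first by rewrite qpoch0 unitr1.
by rewrite qpochS unitrM IH unit_1subq.
Qed.

Lemma overgf_leS N :
  overgf_le N.+1 = overgf_le N * (1 + q ^+ N.+1) / (1 - q ^+ N.+1).
Proof.
rewrite /overgf_le qpochS qpochNS invrM ?unit_qpoch ?unit_1subq //.
by rewrite (mulrC (1 - _)^-1) [qpochN N * (qpoch N)^-1 * _]mulrAC !mulrA.
Qed.

Lemma unit_f r : (0 < r)%N -> f r \is a GRing.unit.
Proof.
move=> r0; rewrite fps_unitE /= big_geq // fps_coef1; exact: oner_neq0.
Qed.

Lemma qpoch_cvg : fps_cvg qpoch (f 1).
Proof.
apply: eq_cvg (f_cvg (ltn0Sn 0)) => N.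
by apply: eq_big_nat => j _; rewrite mul1n.
Qed.

Lemma qpochV_cvg : fps_cvg (fun N => (qpoch N)^-1) (f 1)^-1.
Proof. by apply: cvg_inv qpoch_cvg; [apply: unit_f|apply: unit_qpoch]. Qed.

Lemma qpochM_cvg : fps_cvg (fun N => qpoch N * qpochN N) (f 2).
Proof.
apply: eq_cvg (f_cvg (ltn0Sn 1)) => N.
rewrite -big_split; apply: eq_big_nat => j _ /=.
by rewrite -subr_sqr expr1n -exprM mulnC.
Qed.

Definition overgf : fps := f 2 / f 1 ^+ 2.

Lemma overgf_le_cvg : fps_cvg overgf_le overgf.
Proof.
rewrite /overgf -exprVn.
apply: eq_cvg (cvgM qpochM_cvg (cvgX 2 qpochV_cvg)) => N.
by rewrite expr2 mulrA (mulrC (qpoch N)) mulrK ?unit_qpoch.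
Qed.

Lemma unit_overgf : overgf \is a GRing.unit.
Proof. by rewrite unitrM unitrV unitrX ?unit_f. Qed.

(** * The substitution of -q for q *)

Fact negq_zmod : zmod_morphism negq.
Proof. by move=> a b; apply/fpsP => n /=; rewrite mulrBr. Qed.

Fact negq_monoid : monoid_morphism negq.
Proof.
split=> [|a b]; apply/fpsP => n.
  by rewrite fps_coef1 /=; case: n => [|n] /=; rewrite ?mulr1 ?mulr0.
rewrite /= mulr_sumr; apply: eq_bigr => i _.
rewrite mulrACA -exprD subnKC //; exact: leq_ord.
Qed.

HB.instance Definition _ := GRing.isZmodMorphism.Build fps fps negq negq_zmod.
HB.instance Definition _ :=
  GRing.isMonoidMorphism.Build fps fps negq negq_monoid.

Lemma negq_cvg u (a : fps) :
  fps_cvg u a -> fps_cvg (fun N => negq (u N)) (negq a).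
Proof. by move=> ua n; have [N0 h] := ua n; exists N0 => N /h /= ->. Qed.

Lemma negq_Xn k : negq (q ^+ k) = (-1) ^+ k * q ^+ k.
Proof.
rewrite rmorphXn
  -exprMn; congr (_ ^+ _); apply/fpsP => n.
rewrite mulN1r fps_coefN /=.
by case: eqP => [->|]; rewrite ?mulr1 ?mulr0 ?oppr0.
Qed.

Lemma negqK : involutive negq.
Proof. by move=> a; apply/fpsP => n /=; rewrite signrMK. Qed.

(** * Gauss' identity *)

Definition gauss_term n k : fps :=
  (-1) ^+ k * q ^+ (k ^ 2) * (qpoch n * qpochN n)
    * (qpoch (n - k))^-1 * (qpoch (n + k))^-1.

Definition gauss_cert n k : fps :=
  (-1) ^+ k * q ^+ (k ^ 2 + k + n.+1) * (qpoch n * qpochN n)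
    * (qpoch (n - k))^-1 * (qpoch (n.+1 + k))^-1.

Lemma qpochVS N : (qpoch N)^-1 = (qpoch N.+1)^-1 * (1 - q ^+ N.+1).
Proof.
rewrite qpochS invrM ?unit_qpoch ?unit_1subq // mulrAC.
by rewrite mulVr ?unit_1subq ?mul1r.
Qed.

Lemma qpochMS N :
  qpoch N.+1 * qpochN N.+1 = qpoch N * qpochN N * (1 - (q ^+ N.+1) ^+ 2).
Proof. rewrite qpochS qpochNS; ring. Qed.

Lemma gauss_finite n :
  gauss_term n 0 + 2 * \sum_(1 <= k < n.+1) gauss_term n k = 1.
Proof.
have step N k : (k <= N)%N -> gauss_term N.+1 k - gauss_term N k =
    gauss_cert N k + (-1) ^+ k * q ^+ (k ^ 2) * q ^+ (N.+1 - k)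
      * (qpoch N * qpochN N) * (qpoch (N.+1 - k))^-1 * (qpoch (N + k))^-1.
  move=> kN; rewrite /gauss_term /gauss_cert !exprD qpochMS; apply: gauss_step.
  - by rewrite -exprD; congr (_ ^+ _); lia.
  - by rewrite -exprD qpochVS addSn.
  - by rewrite qpochVS subSn.
rewrite (@wz_sum _ gauss_term gauss_cert).
- by rewrite /gauss_term qpoch0 qpochN0 invr1 !expr0 !mulr1.
- move=> N; rewrite step // /gauss_cert !(subn0, addn0, expr0, add0n).
  by rewrite mulr2n mulrDl !mul1r -!mulrA (mulrC (qpoch N)^-1).
- move=> N k kN; rewrite step //; congr (_ + _).
  rewrite /gauss_cert subSS addSnnS exprS.
  have -> : (k ^ 2 + k + N.+1 = k.+1 ^ 2 + (N - k))%N by lia.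
  by rewrite exprD; ring.
- move=> N; rewrite /gauss_term /gauss_cert !subnn qpochMS qpoch0 invr1 !mulr1.
  rewrite (qpochVS (N.+1 + N)) -addnS -exprM exprS.
  have -> : (N.+1 ^ 2 = N ^ 2 + N + N.+1)%N by lia.
  have -> : (N.+1 + N.+1 = N.+1 * 2)%N by lia.
  by ring.
Qed.

Lemma theta_order k n : (n < k)%N -> ((-1) ^+ k * q ^+ (k ^ 2)).[[n]] = 0.
Proof. by move=> nk; rewrite mulrC coef_lt_order // -mulnn; nia. Qed.

Lemma negq_phi :
  negq phi = 1 + 2 * fps_series (fun k => (-1) ^+ k * q ^+ (k ^ 2)).
Proof.
apply: cvg_unique (negq_cvg phi_cvg) _.
have lim2 := cvgM (cvg_const 2) (cvg_series theta_order).
apply: eq_cvg (cvgD (cvg_const 1) lim2) => N.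
elim: N => [|N IH].
  by rewrite big_geq // big_ord1 mulr0 addr0 /= rmorph1.
rewrite doubleS big_ord_recl big_ord_recr big_nat_recr //= !rmorphD /=.
rewrite mulrDr addrA IH.
have -> : absz ((bump 0 N.*2.+1)%:Z - N.+1%:Z) = N.+1 by rewrite /bump /=; lia.
have -> : \sum_(i < N.*2.+1) q ^+ (absz ((bump 0 i)%:Z - N.+1%:Z) ^ 2) =
    \sum_(i < N.*2.+1) q ^+ (absz (i%:Z - N%:Z) ^ 2).
  by apply: eq_bigr => i _; congr (q ^+ (_ ^ 2)); rewrite /bump /=; lia.
have sgn k : (-1) ^+ (k ^ 2) = (-1) ^+ k :> fps.
  by rewrite -signr_odd oddX /= signr_odd.
rewrite subn0 !negq_Xn sgn; ring.
Qed.

(** Each gauss_term n k tends to (-1)^k q^(k^2) f_2/f_1^2 as n grows, so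
    [gauss_finite] becomes phi(-q) f_2/f_1^2 = 1. *)
Lemma negq_phiE : negq phi = overgf^-1.
Proof.
apply: (mulIr unit_overgf); rewrite mulVr ?unit_overgf //.
rewrite negq_phi mulrDl mul1r -mulrA -fps_seriesMr; last exact: theta_order.
have lim k : fps_cvg (gauss_term^~ k) ((-1) ^+ k * q ^+ (k ^ 2) * overgf).
  rewrite /overgf -exprVn expr2 !mulrA; apply: cvgM; last first.
    exact: cvg_addn qpochV_cvg.
  apply: cvgM; last exact: cvg_subn qpochV_cvg.
  exact: cvgM (cvg_const _) qpochM_cvg.
apply: cvg_unique (cvg_const 1).
apply: eq_cvg gauss_finite _.
apply: cvgD; first by have := lim 0%N; rewrite !expr0 !mul1r.
apply: cvgM (cvg_const 2) _; apply: tannery => // N k n nk.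
by rewrite /gauss_term -!mulrA mulrCA coef_lt_order // -mulnn; nia.
Qed.

(** * Jacobi's four-square theorem *)

Definition jacobi_coef k : fps := 4 * (-1) ^+ k * q ^+ k / (1 + q ^+ k) ^+ 2.

Definition jacobi_term n k : fps :=
  jacobi_coef k * overgf_le n ^+ 2 * overgf_le (n + k) * overgf_le (n - k).

Definition jacobi_cert n k : fps :=
  let X := q ^+ n.+1 in
  let al := overgf_le n / (1 - X) in
  let c := - al ^+ 2 * (4 * X) * (1 + X ^+ 2) / (1 - X ^+ 2) in
  c * (- (-1) ^+ k * overgf_le (n.+1 + k) * overgf_le (n - k)).

Lemma jacobi_coefE k :
  jacobi_coef k * (1 + q ^+ k) ^+ 2 = 4 * (-1) ^+ k * q ^+ k.
Proof. by rewrite divrK ?unitrX ?unit_1addq. Qed.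

Lemma jacobi_coef0 : jacobi_coef 0 = 1.
Proof.
apply: (mulIr (unitrX 2 (unit_1addq 0))).
rewrite jacobi_coefE !expr0; ring.
Qed.

Lemma jacobi_finite n :
  jacobi_term n 0 + 2 * \sum_(1 <= k < n.+1) jacobi_term n k = 1.
Proof.
pose al N := overgf_le N / (1 - q ^+ N.+1).
have al1 N : overgf_le N = al N * (1 - q ^+ N.+1) by rewrite divrK ?unit_1subq.
have al2 N : overgf_le N.+1 = al N * (1 + q ^+ N.+1).
  by rewrite overgf_leS mulrAC.
pose c N : fps := - al N ^+ 2 * (4 * q ^+ N.+1) * (1 + (q ^+ N.+1) ^+ 2)
  / (1 - (q ^+ N.+1) ^+ 2).
have cE N : c N * (1 - (q ^+ N.+1) ^+ 2) =
    - (al N ^+ 2 * (4 * q ^+ N.+1) * (1 + (q ^+ N.+1) ^+ 2)).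
  by rewrite divrK ?mulNr // -exprM unit_1subq.
have step N k : (k <= N)%N -> jacobi_term N.+1 k - jacobi_term N k =
    jacobi_cert N k
      - c N * ((-1) ^+ k * overgf_le (N + k) * overgf_le (N.+1 - k)).
  move=> kN; rewrite /jacobi_cert /= -/(al N) -/(c N) /jacobi_term.
  rewrite addSn subSn //.
  rewrite (al2 N) (al1 N) (al2 (N + k)%N) (al1 (N + k)%N).
  rewrite (al2 (N - k)%N) (al1 (N - k)%N).
  have -> : q ^+ (N + k).+1 = q ^+ N.+1 * q ^+ k by rewrite -exprD addSn.
  apply: jacobi_step (jacobi_coefE k) (cE N).
  by rewrite -exprD; congr (_ ^+ _); lia.
rewrite (@wz_sum _ jacobi_term jacobi_cert).
- by rewrite /jacobi_term overgf_le0 jacobi_coef0 expr1n !mulr1.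
- move=> N; rewrite step // /jacobi_cert /= -/(al N) -/(c N).
  by rewrite !(subn0, addn0) expr0; ring.
- move=> N k kN; rewrite step //; congr (_ - _).
  rewrite /jacobi_cert /= -/(al N) -/(c N) subSS addSnnS exprS; ring.
- move=> N; rewrite /jacobi_cert /jacobi_term /= -/(al N) -/(c N).
  rewrite !subnn overgf_le0 !mulr1 addnS (al2 (N.+1 + N)%N) (al1 (N.+1 + N)%N).
  have -> : q ^+ (N.+1 + N).+1 = q ^+ N.+1 * q ^+ N.+1 by rewrite -exprD addnS.
  rewrite (al2 N) (jacobi_last _ (jacobi_coefE N.+1) (cE N)) exprS; ring.
Qed.

Lemma jacobi_coef_order k n : (n < k)%N -> (jacobi_coef k).[[n]] = 0.
Proof.
by move=> nk; rewrite /jacobi_coef [4 * _ * _]mulrC -mulrA coef_lt_order.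
Qed.

(** The four-square theorem for phi(-q) = 1 / overgf, with the classical divisor
    sum still in the form of a series in the squares of 1/(1+q^k). *)
Lemma jacobi_four_squares :
  overgf^-1 ^+ 4 = 1 + 2 * fps_series jacobi_coef.
Proof.
apply: (mulIr (unitrX 4 unit_overgf)).
rewrite exprVn mulVr ?unitrX ?unit_overgf //.
rewrite mulrDl mul1r -mulrA -fps_seriesMr; last exact: jacobi_coef_order.
have lim k : fps_cvg (jacobi_term^~ k) (jacobi_coef k * overgf ^+ 4).
  have -> : jacobi_coef k * overgf ^+ 4 =
    jacobi_coef k * overgf ^+ 2 * overgf * overgf by ring.
  apply: cvgM; last exact: cvg_subn overgf_le_cvg.
  apply: cvgM; last exact: cvg_addn overgf_le_cvg.
  exact: cvgM (cvg_const _) (cvgX 2 overgf_le_cvg).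
apply: cvg_unique (cvg_const 1) _; apply: eq_cvg jacobi_finite _.
apply: cvgD; first by have := lim 0%N; rewrite jacobi_coef0 mul1r.
apply: cvgM (cvg_const 2) _; apply: tannery => // N k n nk.
rewrite /jacobi_term /jacobi_coef [4 * _ * _]mulrC -!mulrA coef_lt_order //.
Qed.

(** * Overpartitions by their largest part *)

(** A single relation that expresses both the ordering of the parts and the
    rule on overlines; being transitive, it makes the conditions on an
    overpartition local to its head. *)
Definition may_follow (x y : nat * bool) : bool :=
  ((y.1 < x.1) || ((y.1 == x.1) && ~~ y.2))%N.

Lemma is_overpartition_cons n x s :
  is_overpartition n (x :: s) =
  [&& 0 < x.1 <= n, all (may_follow x) s & is_overpartition (n - x.1) s]%N.
Proof.
rewrite /is_overpartition /= path_sortedE; last first.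
  by move=> a b c h1 h2; exact: leq_trans h2 h1.
have -> : all (may_follow x) s =
    all (geq x.1) (unzip1 s) && all (fun y => y.2 ==> (x.1 != y.1)) s.
  rewrite all_map -all_predI; apply: eq_all => -[y b] /=.
  by rewrite /may_follow /= eq_sym; case: ltngtP => //; case: b.
have -> : (x.1 + sumn (unzip1 s) == n)%N =
    (x.1 <= n)%N && (sumn (unzip1 s) == n - x.1)%N.
  by apply/idP/idP; lia.
case: (all (geq x.1) _); rewrite /= ?andbF //.
case: (all (leq 1) _); rewrite /= ?andbF //.
case: (sorted _ _); rewrite /= ?andbF //.
case: (pairwise _ _); rewrite /= ?andbF // !andbT.
by case: (all _ _); rewrite /= ?andbF ?andbT // -?andbA.
Qed.

Definition parts_le m (s : seq (nat * bool)) := all (fun y => y.1 <= m)%N s.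

Lemma all_head_overpartition (p : pred (nat * bool)) n y s :
  (forall z, may_follow y z -> p y -> p z) ->
  is_overpartition n (y :: s) -> all p (y :: s) = p y.
Proof.
move=> pyz; rewrite is_overpartition_cons => /and3P[_ /allP sy _] /=.
case py: (p y) => //=; apply/allP => z /sy yz; exact: pyz yz py.
Qed.

Definition stat_gf (P : pred (seq (nat * bool)))
    (F : seq (nat * bool) -> rat) : fps :=
  Fps (fun n => \sum_(s <- overpartitions n | P s) F s).

(** Removing one part at a time: the lists in P but not in P' are those with
    head x, and the tail of such a list is any overpartition compatible with
    x. *)
Lemma stat_gf_cons x (P P' : pred (seq (nat * bool))) F : (0 < x.1)%N ->
  P [::] = P' [::] ->
  (forall n y s, is_overpartition n (y :: s) ->
     P (y :: s) = (y == x) || P' (y :: s)) ->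
  (forall s, ~~ P' (x :: s)) ->
  stat_gf P F = stat_gf P' F
    + q ^+ x.1 * stat_gf (all (may_follow x)) (fun s => F (x :: s)).
Proof.
move=> x0 P0 PP' P'x; apply/fpsP => n; rewrite fps_coefD fps_coefXnM /=.
rewrite (bigID (fun s => ohead s == Some x)) /= addrC; congr (_ + _).
  rewrite big_seq_cond [RHS]big_seq_cond; apply: eq_bigl => s.
  rewrite mem_overpartitions; case: s => [|y s]; first by rewrite /= P0 andbT.
  case ov: (is_overpartition n _) => //=; rewrite (PP' _ _ _ ov).
  rewrite [Some y == _](_ : _ = (y == x)) //.
  by case: (altP (y =P x)) => [->|_]; rewrite ?andbT //= (negPf (P'x s)).
have mem s : (s \in [seq s <- overpartitions n | P s && (ohead s == Some x)]) =
    [&& x.1 <= n, ohead s == Some x, all (may_follow x) (behead s)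
      & is_overpartition (n - x.1) (behead s)]%N.
  rewrite mem_filter mem_overpartitions; case: s => [|y s].
    by rewrite /= !andbF.
  rewrite /= [Some y == _](_ : _ = (y == x)) //.
  case: (altP (y =P x)) => [->|_]; rewrite ?andbF //= andbT.
  case ov: (is_overpartition n _).
    rewrite (PP' _ _ _ ov) eqxx /=; symmetry.
    by move: ov; rewrite is_overpartition_cons x0.
  by rewrite andbF; move: ov; rewrite is_overpartition_cons x0.
rewrite -big_filter; case: leqP => xn.
  rewrite -[RHS]big_filter -[RHS](big_map (cons x) xpredT F); apply: perm_big.
  apply: uniq_perm.
  - exact/filter_uniq/overpartitions_uniq.
  - rewrite map_inj_uniq; last by move=> s t [].
    exact/filter_uniq/overpartitions_uniq.
  move=> s; rewrite mem xn /=; apply/idP/mapP.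
    case: s => [|y s] //= /and3P[/eqP[->] h1 h2]; exists s => //.
    by rewrite mem_filter h1 mem_overpartitions.
  case=> t; rewrite mem_filter mem_overpartitions => /andP[h1 h2] ->.
  by rewrite /= eqxx h1 h2.
rewrite big_seq big_pred0 // => s; rewrite mem leqNgt xn //.
Qed.

(** Removing a plain part m+1 from the overpartitions without overlined m+1
    stays within them; this is the factor 1/(1-q^(m+1)). *)
Lemma stat_gf_no_overlined m F :
  stat_gf (all (may_follow (m.+1, true))) F = stat_gf (parts_le m) F
    + q ^+ m.+1 * stat_gf (all (may_follow (m.+1, true)))
        (fun s => F ((m.+1, false) :: s)).
Proof.
apply: (@stat_gf_cons (m.+1, false)) => //.
- move=> n y s ov; rewrite /parts_le !(all_head_overpartition _ ov).
  + by case: y {ov} => a [] /=; rewrite /may_follow -?pair_eqE /= ltnS; lia.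
  + by move=> z; rewrite /may_follow; lia.
  + by move=> z; rewrite /may_follow /=; lia.
- by move=> s; rewrite /= ltnn.
Qed.

(** An overlined m+1 comes first and occurs at most once; this is the factor
    1+q^(m+1). *)
Lemma stat_gf_parts_le m F :
  stat_gf (parts_le m.+1) F = stat_gf (all (may_follow (m.+1, true))) F
    + q ^+ m.+1 * stat_gf (all (may_follow (m.+1, true)))
        (fun s => F ((m.+1, true) :: s)).
Proof.
apply: (@stat_gf_cons (m.+1, true)) => //.
- move=> n y s ov; rewrite /parts_le !(all_head_overpartition _ ov).
  + by case: y {ov} => a [] /=; rewrite /may_follow -?pair_eqE /= ltnS; lia.
  + by move=> z; rewrite /may_follow; lia.
  + by move=> z; rewrite /may_follow /=; lia.
- by move=> s; rewrite /= /may_follow /= ltnn eqxx.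
Qed.

Lemma fps_coefCM c (a : fps) n : (fps_const c * a).[[n]] = c * a.[[n]].
Proof.
rewrite fps_coefM big_ord_recl subn0 big1 ?addr0 // => i _.
by rewrite /= mul0r.
Qed.

Definition overlined_sum (c : nat -> rat) (s : seq (nat * bool)) : rat :=
  \sum_(p <- s | p.2) c p.1.

Definition lambert_term (c : nat -> rat) k : fps :=
  fps_const (c k) * (q ^+ k / (1 + q ^+ k)).

Lemma stat_gf_le0 F : stat_gf (parts_le 0) F = fps_const (F [::]).
Proof.
apply/fpsP => n /=; rewrite big_seq_cond.
rewrite (eq_bigl (fun s => (n == 0%N) && (s == [::]))) => [|s]; last first.
  rewrite mem_overpartitions; case: s => [|y s]; last first.
    by rewrite is_overpartition_cons andbF /=; case: ltngtP; rewrite ?andbF.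
  by rewrite /is_overpartition /= !andbT eq_sym.
case: eqP => [->|_] /=; last by rewrite big_pred0.
rewrite -big_filter (_ : filter _ _ = [:: [::] ]) ?big_seq1 //.
rewrite filter_pred1_uniq ?overpartitions_uniq //.
by rewrite mem_overpartitions.
Qed.

Lemma stat_gfD P F F' c :
  stat_gf P (fun s => c * F s + F' s) =
  fps_const c * stat_gf P F + stat_gf P F'.
Proof.
apply/fpsP => n; rewrite fps_coefD fps_coefCM /= big_split mulr_sumr //.
Qed.

Lemma eq_stat_gf P F F' : F =1 F' -> stat_gf P F = stat_gf P F'.
Proof. by move=> FF'; apply/fpsP => n /=; apply: eq_bigr => s _. Qed.

Lemma stat_gf_le_count N : stat_gf (parts_le N) (fun=> 1) = overgf_le N.
Proof.
elim: N => [|N IH]; first by rewrite stat_gf_le0 overgf_le0.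
have := stat_gf_no_overlined N (fun=> 1).
rewrite stat_gf_parts_le overgf_leS -IH.
set L' := stat_gf (all _) _; set L := stat_gf _ _ => L'E.
apply: (mulIr (unit_1subq (ltn0Sn N))); rewrite divrK ?unit_1subq //.
have -> : L = L' * (1 - q ^+ N.+1).
  by rewrite mulrBr mulr1 {1}L'E mulrC addrK.
by ring.
Qed.

(** Let W_N be the left-hand side and A_N = overgf_le N.  The recursions give
      W_(N+1) = (1+X)/(1-X) W_N + c(N+1) X/(1-X) A_N,  X = q^(N+1),
    and division by A_(N+1) = (1+X)/(1-X) A_N makes W_N/A_N telescope. *)
Lemma stat_gf_le_overlined c N :
  stat_gf (parts_le N) (overlined_sum c) =
  overgf_le N * \sum_(1 <= k < N.+1) lambert_term c k.
Proof.
elim: N => [|N IH].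
  by rewrite stat_gf_le0 big_geq // mulr0 /overlined_sum big_nil.
have nc := stat_gf_no_overlined N (fun=> 1).
have nw := stat_gf_no_overlined N (overlined_sum c).
have cons_false s : overlined_sum c ((N.+1, false) :: s) = overlined_sum c s.
  by rewrite /overlined_sum big_cons.
have cons_true s :
    overlined_sum c ((N.+1, true) :: s) = c N.+1 * 1 + overlined_sum c s.
  by rewrite /overlined_sum big_cons mulr1.
rewrite (eq_stat_gf _ cons_false) IH in nw.
rewrite stat_gf_parts_le (eq_stat_gf _ cons_true) stat_gfD.
rewrite stat_gf_le_count in nc; rewrite big_nat_recr //= overgf_leS.
move: nw nc; set A := overgf_le N; set S := \sum_(1 <= k < _) _.
set W := stat_gf _ _; set L := stat_gf _ _; set X := q ^+ N.+1 => WE LE.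
apply: (mulIr (unit_1subq (ltn0Sn N))).
rewrite [RHS]mulrAC divrK ?unit_1subq //.
rewrite /lambert_term -/X [RHS]mulrDr.
have -> : A * (1 + X) * (fps_const (c N.+1) * (X / (1 + X))) =
    A * fps_const (c N.+1) * X * ((1 + X) / (1 + X)) by ring.
rewrite divrr ?unit_1addq // mulr1.
have AL : A = L * (1 - X) by rewrite mulrBr mulr1 {1}LE mulrC addrK.
have AW : A * S = W * (1 - X) by rewrite mulrBr mulr1 {1}WE [X * W]mulrC addrK.
rewrite mulrAC AW AL; ring.
Qed.

Definition lambert (c : nat -> rat) : fps := fps_series (lambert_term c).

Lemma lambert_order c k n : (n < k)%N -> (lambert_term c k).[[n]] = 0.
Proof. by move=> nk; rewrite fps_coefCM coef_lt_order // mulr0. Qed.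

(** The n-th coefficient is reached at rank n, as no part of an overpartition of
    n exceeds n. *)
Lemma overlined_gf c :
  stat_gf predT (overlined_sum c) = overgf * lambert c.
Proof.
apply: cvg_unique (cvgM overgf_le_cvg (cvg_series (@lambert_order c))).
apply: eq_cvg (stat_gf_le_overlined c) _.
move=> n; exists n => N nN /=.
rewrite big_seq_cond [RHS]big_seq_cond; apply: eq_bigl => s.
rewrite mem_overpartitions andbT; case ov: (is_overpartition n s) => //=.
case/and4P: ov => _ _ _ /eqP sn; apply/allP => y ys; apply: leq_trans nN.
by rewrite -sn; apply: leq_sumn; apply: map_f.
Qed.

(** * Coefficients of Lambert series *)

Lemma coef_mul_1addq (a : fps) k n :
  (a * (1 + q ^+ k)).[[n]] = a.[[n]] + if (k <= n)%N then a.[[n - k]] else 0.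
Proof. by rewrite mulrDr mulr1 fps_coefD mulrC fps_coefXnM. Qed.

Lemma divn_subS k n : (0 < k)%N -> (k <= n)%N ->
  (n %/ k = ((n - k) %/ k).+1)%N.
Proof. by move=> k0 kn; rewrite -{1}(subnK kn) divnDr // divnn k0 addn1. Qed.

Lemma coef_alternating_geometric k n : (0 < k)%N ->
  (q ^+ k / (1 + q ^+ k)).[[n]] =
  if (0 < n)%N && (k %| n)%N then (-1) ^+ (n %/ k).+1 else 0.
Proof.
move=> k0; pose g := Fps (fun n =>
  if (0 < n)%N && (k %| n)%N then (-1) ^+ (n %/ k).+1 else 0).
suff -> : q ^+ k / (1 + q ^+ k) = g by [].
apply: (mulIr (unit_1addq k)); rewrite divrK ?unit_1addq //.
apply/fpsP => m; rewrite coef_mul_1addq fps_coefXn /=.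
case: (leqP k m) => [km|mk]; last first.
  rewrite addr0 ltn_eqF //; case: ifP => // /andP[m0 /dvdn_leq]; lia.
rewrite dvdn_subl // (leq_trans k0 km) /= subn_gt0; case: ltngtP km => // km _.
  case: ifP => [km'|]; last by rewrite addr0.
  by rewrite (divn_subS k0 (ltnW km)) exprS mulN1r addNr.
by rewrite km dvdnn divnn -km k0 addr0 sqrrN expr1n.
Qed.

Lemma coef_alternating_geometric_sqr k n : (0 < k)%N ->
  (q ^+ k / (1 + q ^+ k) ^+ 2).[[n]] =
  if (k %| n)%N then (-1) ^+ (n %/ k).+1 * (n %/ k)%:R else 0.
Proof.
move=> k0; pose g := Fps (fun n =>
  if (k %| n)%N then (-1) ^+ (n %/ k).+1 * (n %/ k)%:R else 0).
suff -> : q ^+ k / (1 + q ^+ k) ^+ 2 = g by [].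
have u := unit_1addq k.
apply: (mulIr u); rewrite expr2 invrM // mulrA divrK //.
apply/fpsP => m; rewrite coef_mul_1addq coef_alternating_geometric //=.
case: (leqP k m) => [km|mk]; last first.
  rewrite addr0; case: m mk => [|m] mk /=; first by rewrite dvdn0 div0n mulr0.
  by case: ifP => // /dvdn_leq; lia.
rewrite dvdn_subl // (leq_trans k0 km) /=.
case: ifP => [km'|]; last by rewrite addr0.
rewrite (divn_subS k0 km); set j := (_ %/ _)%N.
by rewrite -[j.+1%:R]natr1 exprS; ring.
Qed.

(** Empty at n = 0, unlike the list [divisors 0]; so the coefficient formulas
    below hold at n = 0 as well. *)
Definition divisors_in n := [seq d <- index_iota 1 n.+1 | d %| n]%N.

Lemma mem_divisors_in d n : (d \in divisors_in n) = (0 < n)%N && (d %| n)%N.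
Proof.
rewrite mem_filter mem_index_iota andbC.
case: (posnP n) => [->|n0]; first by lia.
case dn: (d %| n)%N; rewrite ?andbF //= andbT.
by rewrite (dvdn_gt0 n0 dn) ltnS dvdn_leq.
Qed.

Lemma divisors_in0 : divisors_in 0 = [::]. Proof. by []. Qed.

Lemma divisors_in_uniq n : uniq (divisors_in n).
Proof. exact/filter_uniq/iota_uniq. Qed.

Lemma sum_divisors (F : nat -> rat) n :
  \sum_(1 <= k < n.+1) (if (k %| n)%N then F k else 0) =
  \sum_(d <- divisors_in n) F d.
Proof. by rewrite -big_mkcond -big_filter. Qed.

Lemma sum_divisors_compl (F : nat -> rat) n :
  \sum_(d <- divisors_in n) F (n %/ d)%N = \sum_(d <- divisors_in n) F d.
Proof.
case: (posnP n) => [->|n0]; first by rewrite !divisors_in0 !big_nil.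
rewrite -(big_map (fun d => n %/ d)%N xpredT F); apply: perm_big.
have inv d : (d %| n)%N -> (n %/ (n %/ d) = d)%N.
  by move=> dn; rewrite divnA // mulnC mulnK.
have inj : {in divisors_in n &, injective (fun d => n %/ d)%N}.
  by move=> d e; rewrite !mem_divisors_in n0 /= => /inv {2}<- /inv {2}<- ->.
apply: uniq_perm.
- by rewrite map_inj_in_uniq ?divisors_in_uniq.
- exact: divisors_in_uniq.
move=> d; apply/mapP/idP => [[e]|].
  by rewrite !mem_divisors_in n0 /= => en ->; apply: dvdn_div.
by rewrite mem_divisors_in n0 /= => dn; exists (n %/ d)%N;
  rewrite ?inv // mem_divisors_in n0 /= dvdn_div.
Qed.

Lemma coef_lambert c n :
  (lambert c).[[n]] = \sum_(d <- divisors_in n) c d * (-1) ^+ (n %/ d).+1.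
Proof.
rewrite -sum_divisors /= fps_coef_sum; apply: eq_big_nat => k /andP[k0 kn].
rewrite fps_coefCM coef_alternating_geometric // (leq_trans k0) //=.
by case: ifP; rewrite ?mulr0.
Qed.

Lemma lambertB c c' : lambert (fun k => c k - c' k) = lambert c - lambert c'.
Proof.
apply/fpsP => n; rewrite fps_coefD fps_coefN !coef_lambert -sumrB.
by apply: eq_bigr => d _; rewrite mulrBl.
Qed.

Lemma fps_constM c c' : fps_const (c * c') = fps_const c * fps_const c'.
Proof.
by apply/fpsP => n; rewrite fps_coefCM /=; case: eqP; rewrite ?mulr0.
Qed.

Lemma fps_const_sign k : fps_const ((-1) ^+ k) = (-1) ^+ k.
Proof.
elim: k => [|k IH] //; rewrite !exprS fps_constM IH; congr (_ * _).
by apply/fpsP => n; rewrite fps_coefN fps_coef1 /=; case: n.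
Qed.

(** Both sides are double series over the factorisations n = k m, expanded along
    k on the left and along m on the right; the common summand is
    4 (-1)^(k+m+1) m. *)
Lemma series_jacobi_coef :
  fps_series jacobi_coef = 4 * lambert (fun k => (-1) ^+ k * k%:R).
Proof.
have four : (4 : fps) = fps_const 4.
  by apply/fpsP => n /=; case: n.
apply/fpsP => n; rewrite four fps_coefCM coef_lambert mulr_sumr.
rewrite -[RHS]sum_divisors_compl -sum_divisors /= fps_coef_sum.
apply: eq_big_nat => k /andP[k0 kn].
have -> : jacobi_coef k =
    fps_const (4 * (-1) ^+ k) * (q ^+ k / (1 + q ^+ k) ^+ 2).
  by rewrite fps_constM -four fps_const_sign /jacobi_coef -!mulrA.
rewrite fps_coefCM coef_alternating_geometric_sqr //.
case: ifP => [kn'|]; last by rewrite mulr0.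
by rewrite divnA // mulKn ?(leq_trans k0) // !exprS; ring.
Qed.

(** * The odd and the even part of the divisor sum *)

Definition odd_part_val k : rat := if odd k then k%:R else 0.
Definition even_part_val k : rat := if odd k then 0 else k%:R.

(** As q^k/(1+q^k) = q^k/(1-q^k) - 2 q^(2k)/(1-q^(2k)), the even terms of
    \sum_k k q^k/(1-q^k) cancel in \sum_k k q^k/(1+q^k). *)
Lemma odd_add_even_lambert n :
  (lambert odd_part_val).[[n]] + (lambert even_part_val).[[n]] =
  \sum_(d <- divisors_in n) odd_part_val d.
Proof.
rewrite !coef_lambert -big_split /=.
case: (posnP n) => [->|n0]; first by rewrite !divisors_in0 !big_nil.
transitivity (\sum_(d <- divisors_in n) d%:R
    - \sum_(d <- divisors_in n | ~~ odd (n %/ d)) (d.*2)%:R : rat).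
  rewrite [X in _ - X]big_mkcond -sumrB; apply: eq_bigr => d _.
  rewrite -mulrDl -signr_odd /= /odd_part_val /even_part_val -mul2n natrM.
  by case: (odd d); case: (odd _); rewrite /=; ring.
have -> : \sum_(d <- divisors_in n | ~~ odd (n %/ d)) (d.*2)%:R =
    \sum_(d <- divisors_in n | ~~ odd d) d%:R :> rat.
  rewrite -big_filter -[RHS]big_filter.
  rewrite -[LHS](big_map double xpredT (fun d => d%:R)).
  apply/perm_big/uniq_perm.
  - rewrite map_inj_uniq; last exact: double_inj.
    exact/filter_uniq/divisors_in_uniq.
  - exact/filter_uniq/divisors_in_uniq.
  move=> d; rewrite mem_filter mem_divisors_in n0 /=; apply/mapP/idP.
    case=> e; rewrite mem_filter mem_divisors_in n0 /= => /andP[ev en] ->.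
    rewrite odd_double -(divnK en) -muln2 mulnC dvdn_pmul2r ?dvdn2 //.
    exact: dvdn_gt0 en.
  case/andP=> ev dn; exists d./2; last by rewrite even_halfK.
  rewrite mem_filter mem_divisors_in n0 /=.
  have dE : d = (d./2 * 2)%N by rewrite muln2 even_halfK.
  have h : (d./2 %| n)%N by apply: dvdn_trans dn; rewrite {2}dE dvdn_mulr.
  rewrite h -dvdn2 andbT -(@dvdn_pmul2r d./2); last exact: dvdn_gt0 h.
  by rewrite divnK // mulnC -dE.
rewrite [X in _ - X]big_mkcond -sumrB; apply: eq_bigr => d _.
by rewrite /odd_part_val; case: odd; rewrite /= ?subr0 ?subrr.
Qed.

(** Let o and e be the n-th coefficients of the two Lambert series.  For n odd,
    e = 0.  For n even, n/d is even for all odd d, so o is minus the sum of the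
    odd divisors, which is o + e by [odd_add_even_lambert]; hence e = -2 o.  In
    both cases (-1)^n (e - o) = o + 2 e. *)
Lemma negq_lambert :
  negq (lambert even_part_val - lambert odd_part_val) =
  lambert odd_part_val + 2 * lambert even_part_val.
Proof.
apply/fpsP => n.
have -> : 2 * lambert even_part_val =
    lambert even_part_val + lambert even_part_val.
  by ring.
rewrite -[LHS]/((-1) ^+ n * _.[[n]]) !fps_coefD fps_coefN -signr_odd.
case: (posnP n) => [->|n0].
  by rewrite !coef_lambert !divisors_in0 !big_nil.
case on: (odd n).
  have -> : (lambert even_part_val).[[n]] = 0; last by rewrite /=; ring.
  rewrite coef_lambert big_seq big1 // => d.
  rewrite mem_divisors_in n0 /= => dn.
  by rewrite /even_part_val (dvdn_odd dn on) mul0r.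
have E := odd_add_even_lambert n.
have O : (lambert odd_part_val).[[n]] =
    - \sum_(d <- divisors_in n) odd_part_val d.
  rewrite coef_lambert -sumrN !big_seq; apply: eq_bigr => d.
  rewrite mem_divisors_in n0 /= => dn; rewrite /odd_part_val.
  case od: (odd d); last by rewrite mul0r oppr0.
  have: odd (n %/ d) = false.
    by move: on; rewrite -{1}(divnK dn) oddM od andbT.
  by rewrite -signr_odd /= => ->; rewrite mulrN1.
move: E O; rewrite /= expr0; lra.
Qed.

(** * The generating functions *)

Lemma gf_OSOMEo : Fps (fun n => (OSOMEo n)%:R) = overgf * lambert odd_part_val.
Proof.
rewrite -overlined_gf; apply/fpsP => n /=; rewrite natr_sum.
apply: eq_bigr => s _; rewrite natr_sum big_mkcondr /=.
by apply: eq_bigr => p _.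
Qed.

Lemma gf_OSOMEe : Fps (fun n => (OSOMEe n)%:R) = overgf * lambert even_part_val.
Proof.
rewrite -overlined_gf; apply/fpsP => n /=; rewrite natr_sum.
apply: eq_bigr => s _; rewrite natr_sum big_mkcondr /=.
by apply: eq_bigr => p _; rewrite /even_part_val; case: odd.
Qed.

Lemma negq_phi_pow4 :
  negq phi ^+ 4 = 1 + 8 * (lambert even_part_val - lambert odd_part_val).
Proof.
rewrite negq_phiE jacobi_four_squares series_jacobi_coef -lambertB.
have -> : lambert (fun k => (-1) ^+ k * k%:R) =
    lambert (fun k => even_part_val k - odd_part_val k).
  apply/fpsP => n; rewrite !coef_lambert; apply: eq_bigr => k _.
  rewrite /even_part_val /odd_part_val -signr_odd.
  by case: odd; rewrite /= ?expr0 ?expr1; ring.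
by ring.
Qed.

Lemma phi_pow4 :
  phi ^+ 4 = 1 + 8 * (lambert odd_part_val + 2 * lambert even_part_val).
Proof.
rewrite -[phi]negqK -rmorphXn /= negq_phi_pow4 -negq_lambert.
by rewrite rmorphD rmorphM rmorph1 /= rmorph_nat.
Qed.

Theorem theorem1p1 :
  [/\ Fps (fun n => (OSOME n)%:~R) = 8^-1 * (f 2 / f 1 ^+ 2 - f 1 ^+ 6 / f 2 ^+ 3),
      8^-1 * (f 2 / f 1 ^+ 2 - f 1 ^+ 6 / f 2 ^+ 3)
        = 8^-1 * ((negq phi)^-1 - negq phi ^+ 3),
      Fps (fun n => (OSOMEo n)%:R)
        = (24 * negq phi)^-1 * (phi ^+ 4 - 2 * negq phi ^+ 4 + 1)
    & Fps (fun n => (OSOMEe n)%:R)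
        = (24 * negq phi)^-1 * (phi ^+ 4 + negq phi ^+ 4 - 2)].
Proof.
have unit_nat m : (0 < m)%N -> (m%:R : fps) \is a GRing.unit.
  move=> m0; rewrite fps_unitE.
  have -> : (m%:R : fps).[[0]] = m%:R.
    by elim: m {m0} => // m IH; rewrite !mulrSr fps_coefD IH.
  by rewrite pnatr_eq0 -lt0n.
have phiV : (negq phi)^-1 = overgf by rewrite negq_phiE invrK.
have u := unit_overgf.
have eq_f : f 2 / f 1 ^+ 2 - f 1 ^+ 6 / f 2 ^+ 3 = (negq phi)^-1 - negq phi ^+ 3.
  rewrite phiV negq_phiE; congr (_ - _).
  have -> : overgf^-1 = f 1 ^+ 2 / f 2.
    by rewrite [LHS]invrM ?unitrV ?unitrX ?unit_f // invrK.
  by rewrite exprMn exprVn -exprM.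
have split4 : negq phi ^+ 3 = overgf * negq phi ^+ 4.
  by rewrite [in RHS]exprS mulrA -phiV mulVr ?mul1r // -unitrV phiV.
rewrite [(24 * _)^-1]invrM ?unit_nat //; last by rewrite -unitrV phiV.
rewrite eq_f phiV split4 gf_OSOMEo gf_OSOMEe phi_pow4 negq_phi_pow4.
have cancel m (a b : fps) : (0 < m)%N -> m%:R * a = b -> a = (m%:R)^-1 * b.
  by move=> m0 <-; rewrite mulKr ?unit_nat.
split=> //.
- apply: cancel => //.
  have -> : Fps (fun n => (OSOME n)%:~R) =
      overgf * lambert odd_part_val - overgf * lambert even_part_val.
    rewrite -gf_OSOMEo -gf_OSOMEe; apply/fpsP => n.
    by rewrite fps_coefD fps_coefN /= /OSOME rmorphB.
  by ring.
- by rewrite [overgf / _]mulrC -[RHS]mulrA; apply: cancel => //; ring.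
- by rewrite [overgf / _]mulrC -[RHS]mulrA; apply: cancel => //; ring.
Qed.
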